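(* Let $p,q,r$ be pairwise distinct primes with $p<q$ and $p<r$, and let $A=\max_n |a_{pqr}(n)|$. Let $q',r'\in\{1,\dots,p-1\}$ be the inverses of $q$ and $r$ modulo $p$, let $\alpha=\min\{q',r',p-q',p-r'\}$, let $\beta$ be the unique integer with $0<\beta<p$ and $\alpha\beta qr\equiv 1\pmod p$, and put $\beta^*=\min\{\beta,p-\beta\}$. Then $$A\le \min\{2\alpha+\beta^*,\;p-\beta^*\}.$$
   Context: $\Phi_{pqr}(x)=\prod_{0<k<pqr,\ \gcd(k,pqr)=1}(x-\zeta^k)$, where $\zeta$ is a primitive $pqr$-th root of unity, is the ternary cyclotomic polynomial; $a_{pqr}(n)$ denotes its coefficient of $x^n$ (zero for $n$ outside $[0,\deg\Phi_{pqr}]$). *)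

(* Defs.v *)
From mathcomp Require Import all_boot all_order all_algebra all_field.
Set Implicit Arguments. Unset Strict Implicit. Unset Printing Implicit Defensive.
Import GRing.Theory Num.Theory.

(* a_n(k) : coefficient of x^k in the n-th cyclotomic polynomial 'Phi_n
   (MathComp's integral cyclotomic polynomial, whose image in algC is
   \prod_{gcd(k,n)=1} (X - z^k) for a primitive n-th root z).
   Coefficients outside [0, deg] are 0 (nth default). *)
Definition cyc_coef (n k : nat) : int := ('Phi_n)`_k.

Definition cyc_height (n : nat) : nat :=
  \max_(k < size ('Phi_n)) absz (cyc_coef n k).

(* Main.v *)
Require Import Defs.
From mathcomp Require Import all_boot all_order all_algebra all_field.
From mathcomp Require Import zify ring.
Import GRing.Theory Num.Theory Order.TTheory.
Set Implicit Arguments. Unset Strict Implicit. Unset Printing Implicit Defensive.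

(** Every integer [m] is uniquely [x q r + y p r + z p q - k p q r] with
    [0 <= x < p], [0 <= y < q], [0 <= z < r]. From
      [Phi_pqr (X^pqr - 1)^2
         = (1 + ... + X^(p-1)) (X^q - 1) (X^r - 1)
           (sum_x X^(xqr)) (sum_y X^(ypr)) (sum_z X^(zpq))]
    the coefficient of [X^n] is the sum over the window [n - p < m <= n] of
      [f m = [k_m = 0] - [k_(m-q) = 0] - [k_(m-r) = 0] + [k_(m-q-r) = 0]],
    and the carries [k] occurring there lie in [{0, 1, 2}].
    Passing from [m] to [m - q] shifts [x] cyclically by the inverse [s] of [r]
    mod [p], shifts [z], fixes [y], and changes [k] by [-1] plus the number of
    wrap-arounds; likewise for [m - r] with the inverse [t] of [q].  Hence, for
    [s <= t], the sign of [f m] is controlled by the position of [x] relative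
    to [s], [t] and [s + t], while [f m] can only be nonzero away from two
    blocks of length [min (s, p - t)] if some carry is [0] and another is [2].
    Since [k = 0] forces [x <= n / qr] and [k = 2] forces [x > n / qr], this
    confines [x] to a short interval.  As [x] runs through all residues once
    over the window, counting them gives the bounds; [beta] is [t] or [p - s]
    according to whether [alpha] is [s] or [p - t]. *)

(** * Digits and carry of an integer with respect to [p], [q], [r] *)

Section Decomposition.
Local Open Scope ring_scope.

Definition decomposes (p q r : nat) (m x y z k : int) : Prop :=
  [/\ 0 <= x < p%:Z, 0 <= y < q%:Z, 0 <= z < r%:Z &
      m = x * q%:Z * r%:Z + y * p%:Z * r%:Z + z * p%:Z * q%:Z
          - k * p%:Z * q%:Z * r%:Z].

Lemma residue_unique (p : nat) (e x x' : int) :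
  coprimez p%:Z e -> 0 <= x < p%:Z -> 0 <= x' < p%:Z ->
  (p%:Z %| (x - x') * e)%Z -> x = x'.
Proof.
move=> co xP x'P; rewrite Gauss_dvdzl // => /dvdzP [j].
have [->|[j1|j1]] : j = 0 \/ j <= -1 \/ 1 <= j by lia.
- by lia.
- by nia.
- by nia.
Qed.

(** Modulo [p] only the term in [x] survives, and [q r] is invertible there; [y] and [z] are
    symmetric, and [k] follows by cancellation. *)
Lemma decomposes_unique (p q r : nat) (m x y z k x' y' z' k' : int) :
  coprime p q -> coprime p r -> coprime q r ->
  decomposes p q r m x y z k -> decomposes p q r m x' y' z' k' ->
  [/\ x = x', y = y', z = z' & k = k'].
Proof.
move=> pq pr qr [xP yP zP ->] [xP' yP' zP' E].
have Ex : x = x'.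
  apply: (@residue_unique p (q%:Z * r%:Z)) => //.
    by rewrite coprimezMr; apply/andP; split.
  apply/dvdzP.
  (* The difference of the two representations, with [(x - x') q r] isolated and [p] divided out. *)
  exists ((k - k') * q%:Z * r%:Z - (y - y') * r%:Z - (z - z') * q%:Z).
  by lia.
have Ey : y = y'.
  apply: (@residue_unique q (p%:Z * r%:Z)) => //.
    by rewrite coprimezMr; apply/andP; split => //; rewrite coprimez_sym.
  apply/dvdzP.
  exists ((k - k') * p%:Z * r%:Z - (x - x') * r%:Z - (z - z') * p%:Z).
  by lia.
have Ez : z = z'.
  apply: (@residue_unique r (p%:Z * q%:Z)) => //.
    by rewrite coprimezMr; apply/andP; split => //; rewrite coprimez_sym.
  apply/dvdzP.
  exists ((k - k') * p%:Z * q%:Z - (x - x') * q%:Z - (y - y') * p%:Z).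
  by lia.
split=> //; move: E; rewrite -Ex -Ey -Ez => /addrI/oppr_inj.
have p0 : p%:Z != 0 by lia.
have q0 : q%:Z != 0 by lia.
have r0 : r%:Z != 0 by lia.
by move=> /(mulIf r0) /(mulIf q0) /(mulIf p0).
Qed.

Lemma decomposition_exists (p q r : nat) :
  (0 < p)%N -> (0 < q)%N -> (0 < r)%N ->
  coprime p q -> coprime p r -> coprime q r ->
  exists X Y Z K : int -> int,
    forall m, decomposes p q r m (X m) (Y m) (Z m) (K m).
Proof.
move=> p0 q0 r0 pq pr qr.
have [u [v uv]] := Bezoutz q%:Z r%:Z.
have [a [b ab]] := Bezoutz p%:Z (q%:Z * r%:Z).
have {}uv : u * q%:Z + v * r%:Z = 1.
  by rewrite uv; move/eqP: (qr : coprimez q%:Z r%:Z).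
have {}ab : a * p%:Z + b * (q%:Z * r%:Z) = 1.
  rewrite ab; apply/eqP; change (coprimez p%:Z (q%:Z * r%:Z)).
  by rewrite coprimezMr; apply/andP; split.
(* Since [u q + v r = 1] and [a p + b q r = 1], [m] equals [m b q r + m a v p r + m a u p q].
   Reducing the three coefficients modulo [p], [q], [r] moves the quotients into the carry. *)
exists (fun m => (m * b %% p%:Z)%Z), (fun m => (m * a * v %% q%:Z)%Z),
  (fun m => (m * a * u %% r%:Z)%Z),
  (fun m => - ((m * b %/ p%:Z)%Z + (m * a * v %/ q%:Z)%Z
               + (m * a * u %/ r%:Z)%Z)) => m.
have modP (d : nat) (n : int) : (0 < d)%N -> 0 <= (n %% d%:Z)%Z < d%:Z.
  by move=> d0; rewrite modz_ge0 ?ltz_pmod //; lia.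
split; try exact: modP.
have e1 := divz_eq (m * b) p%:Z.
have e2 := divz_eq (m * a * v) q%:Z.
have e3 := divz_eq (m * a * u) r%:Z.
move: (m * b %% p)%Z (m * b %/ p)%Z (m * a * v %% q)%Z (m * a * v %/ q)%Z
  (m * a * u %% r)%Z (m * a * u %/ r)%Z e1 e2 e3 => x x' y y' z z' e1 e2 e3.
transitivity (m * b * (q%:Z * r%:Z) + m * a * v * p%:Z * r%:Z
              + m * a * u * p%:Z * q%:Z).
  transitivity (m * (a * p%:Z * (u * q%:Z + v * r%:Z) + b * (q%:Z * r%:Z))).
    by rewrite uv mulr1 ab mulr1.
  by ring.
by rewrite e1 e2 e3; ring.
Qed.

(* [s] and [c] are the inverses of [r] mod [p] and of [p] mod [r]. *)
Lemma decomposes_sub (p q r s c : nat) (m x y z k : int) :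
  (0 < s <= p)%N -> (0 < c <= r)%N -> (s * r + c * p = 1 + p * r)%N ->
  decomposes p q r m x y z k ->
  decomposes p q r (m - q%:Z)
    (x - s%:Z + (x < s%:Z)%R%:Z * p%:Z) y (z - c%:Z + (z < c%:Z)%R%:Z * r%:Z)
    (k - 1 + (x < s%:Z)%R%:Z + (z < c%:Z)%R%:Z).
Proof.
move=> sP cP E [xP yP zP ->].
have {}E : s%:Z * r%:Z + c%:Z * p%:Z = 1 + p%:Z * r%:Z by lia.
split=> //.
- by case: ltP => ?; lia.
- by case: ltP => ?; lia.
(* Times [q], the relation reads [q = s q r + c p q - p q r]: subtracting [q] takes 1 from the
   carry, and each wrap-around gives 1 back. *)
have := congr1 ( *%R q%:Z) E; move: (nat_of_bool _) (nat_of_bool _) => i j.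
by lia.
Qed.

Lemma decomposes_swap (p q r : nat) (m x y z k : int) :
  decomposes p q r m x y z k -> decomposes p r q m x z y k.
Proof. by move=> [xP yP zP ->]; split=> //; ring. Qed.

End Decomposition.

(** * Product formula for the ternary cyclotomic polynomial *)

Section CyclotomicProducts.
Local Open Scope ring_scope.

Lemma perm_divisors_prime_mul (p m : nat) : prime p -> ~~ (p %| m)%N ->
  (0 < m)%N ->
  perm_eq (divisors (p * m)) (divisors m ++ [seq (p * d)%N | d <- divisors m]).
Proof.
move=> pr_p pm m0; have p0 := prime_gt0 pr_p.
apply: uniq_perm; first exact: divisors_uniq.
- rewrite cat_uniq divisors_uniq map_inj_uniq ?divisors_uniq ?andbT; last first.
    by move=> a b /eqP; rewrite eqn_pmul2l // => /eqP.
  apply/hasPn => _ /mapP [d _ ->]; apply: contra pm.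
  rewrite -dvdn_divisors // => /(dvdn_trans _); apply; exact: dvdn_mulr.
move=> d; rewrite mem_cat -!dvdn_divisors ?muln_gt0 ?p0 //.
apply/idP/orP.
- case: (boolP (p %| d)%N) => [/dvdnP [e ->]|pd].
    rewrite [(e * p)%N]mulnC dvdn_pmul2l // => em; right.
    by apply: map_f; rewrite -dvdn_divisors.
  by rewrite Gauss_dvdr 1?coprime_sym ?prime_coprime //; left.
- case=> [|/mapP [e]]; first exact: dvdn_mull.
  by rewrite -dvdn_divisors // => em ->; rewrite dvdn_pmul2l.
Qed.

Lemma Xn_prime_mul_sub1 (p m : nat) : prime p -> ~~ (p %| m)%N -> (0 < m)%N ->
  'X^(p * m) - 1 =
  ('X^m - 1) * \prod_(d <- divisors m) 'Phi_(p * d) :> {poly int}.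
Proof.
move=> pr_p pm m0; have p0 := prime_gt0 pr_p.
rewrite -prod_Cyclotomic ?muln_gt0 ?p0 // -prod_Cyclotomic //.
by rewrite (perm_big _ (perm_divisors_prime_mul pr_p pm m0)) big_cat big_map.
Qed.

(** The Moebius product formula, cleared of denominators. Each factor whose exponent is a multiple
    of [p] is split into the factor with [p] removed and the [Phi_d] with [p | d]; both sides then
    agree. *)
Lemma Phi_ternaryE (p q r : nat) : prime p -> prime q -> prime r ->
  p != q -> p != r -> q != r ->
  'Phi_(p * q * r) * (('X^(p * q) - 1) * ('X^(p * r) - 1) * ('X^(q * r) - 1)
                      * ('X - 1)) =
  ('X^(p * q * r) - 1) * ('X^p - 1) * ('X^q - 1) * ('X^r - 1) :> {poly int}.
Proof.
move=> pp pq pr npq npr nqr.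
have p1 := prime_gt1 pp.
have ndvd a b : prime a -> prime b -> a != b -> ~~ (a %| b)%N.
  by move=> pa pb; rewrite dvdn_prime2.
have pqr : ~~ (p %| q * r)%N by rewrite Euclid_dvdM // negb_or !ndvd.
have divp a : prime a -> perm_eq (divisors a) [:: 1%N; a].
  move=> pa; have := @perm_divisors_prime_mul a 1 pa _ isT; rewrite /= !muln1.
  by apply; rewrite dvdn1; case: a pa => [|[|]].
have Ep : 'X^p - 1 = ('X - 1) * 'Phi_p :> {poly int}.
  have := @Xn_prime_mul_sub1 p 1 pp; rewrite muln1 => -> //; last first.
    by rewrite dvdn1; case: p p1 {pp npq npr pqr} => [|[|]].
  by rewrite expr1 big_seq1 muln1.
have Epa a : prime a -> p != a ->
    'X^(p * a) - 1 = ('X^a - 1) * ('Phi_p * 'Phi_(p * a)) :> {poly int}.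
  move=> pa npa; rewrite Xn_prime_mul_sub1 ?ndvd ?prime_gt0 //.
  by rewrite (perm_big _ (divp a pa)) big_cons big_seq1 muln1.
have Epqr : 'X^(p * q * r) - 1 = ('X^(q * r) - 1) *
    ('Phi_p * 'Phi_(p * q) * 'Phi_(p * r) * 'Phi_(p * q * r)) :> {poly int}.
  rewrite -mulnA Xn_prime_mul_sub1 // ?muln_gt0 ?prime_gt0 //; congr (_ * _).
  rewrite (perm_big _ (@perm_divisors_prime_mul q r _ _ _)) ?ndvd ?prime_gt0 //.
  rewrite big_cat big_map !(perm_big _ (divp r pr)) /= !big_cons !big_nil.
  by rewrite !muln1; ring.
by rewrite Epqr !Epa // Ep; ring.
Qed.

End CyclotomicProducts.

(** * Coefficients as window sums of second differences *)

Section CoefficientFormula.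
Local Open Scope ring_scope.

(** Generating polynomial of the integers of carry 0. *)
Definition geom_box (p q r : nat) : {poly int} :=
  (\sum_(i < p) 'X^(q * r) ^+ i) * (\sum_(i < q) 'X^(p * r) ^+ i)
  * (\sum_(i < r) 'X^(p * q) ^+ i).

Lemma Xn_sub1_neq0 (n : nat) : (0 < n)%N -> 'X^n - 1 != 0 :> {poly int}.
Proof. by move=> n0; rewrite -size_poly_eq0 size_XnsubC. Qed.

Lemma Phi_ternary_geom (p q r : nat) : prime p -> prime q -> prime r ->
  p != q -> p != r -> q != r ->
  'Phi_(p * q * r) * ('X^(p * q * r) - 1) ^+ 2 =
  (\sum_(i < p) 'X^i) * ('X^q - 1) * ('X^r - 1) * geom_box p q r.
Proof.
move=> pp pq pr npq npr nqr.
have [p0 q0 r0] : [/\ (0 < p)%N, (0 < q)%N & (0 < r)%N] by rewrite !prime_gt0.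
have H := Phi_ternaryE pp pq pr npq npr nqr.
have Hp := subrX1 ('X : {poly int}) p.
have Ha : 'X^(p * q * r) - 1 =
    ('X^(q * r) - 1) * \sum_(i < p) 'X^(q * r) ^+ i :> {poly int}.
  by rewrite -subrX1 -exprM; congr ('X^_ - 1); lia.
have Hb : 'X^(p * q * r) - 1 =
    ('X^(p * r) - 1) * \sum_(i < q) 'X^(p * r) ^+ i :> {poly int}.
  by rewrite -subrX1 -exprM; congr ('X^_ - 1); lia.
have Hc : 'X^(p * q * r) - 1 =
    ('X^(p * q) - 1) * \sum_(i < r) 'X^(p * q) ^+ i :> {poly int}.
  by rewrite -subrX1 -exprM.
have X1 : 'X - 1 != 0 :> {poly int} by exact: (@Xn_sub1_neq0 1 isT).
have E0 : 'X^(p * q * r) - 1 != 0 :> {poly int}.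
  by apply: Xn_sub1_neq0; rewrite !muln_gt0 p0 q0.
(* This produces the cube of [X^pqr - 1]; each copy supplies one denominator of the product formula
   and one geometric sum. *)
apply: (mulfI E0); apply: (mulfI X1); rewrite /geom_box.
move: ('X^(p * q * r) - 1) (\sum_(i < p) 'X^(q * r) ^+ i)
  (\sum_(i < q) 'X^(p * r) ^+ i) (\sum_(i < r) 'X^(p * q) ^+ i)
  ('X^(q * r) - 1) ('X^(p * r) - 1) ('X^(p * q) - 1) H Hp Ha Hb Hc {E0}
  => E ga gb gc a b c H Hp Ha Hb Hc.
set F := 'Phi_ _ in H *.
transitivity (F * (c * b * a * ('X - 1)) * (ga * gb * gc)).
  transitivity (('X - 1) * F * (E * E * E)); first by ring.
  by rewrite {1}Ha {1}Hb Hc; ring.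
by rewrite H Hp; ring.
Qed.

Context (p q r : nat) (X Y Z K : int -> int).
Hypotheses (pq : coprime p q) (pr : coprime p r) (qr : coprime q r).
Hypothesis XYZK : forall m, decomposes p q r m (X m) (Y m) (Z m) (K m).

(** Uniqueness of the digits makes the exponents of the expanded product distinct, so no coefficient
    exceeds 1. *)
Lemma coef_geom_box (n : nat) : (geom_box p q r)`_n = (K n%:Z == 0)%:R.
Proof.
pose F (t : 'I_p * 'I_q * 'I_r) : nat :=
  (t.1.1 * (q * r) + t.1.2 * (p * r) + t.2 * (p * q))%N.
have -> : geom_box p q r = \sum_t 'X^(F t).
  rewrite /geom_box big_distrlr pair_big /= big_distrlr pair_big /=.
  apply: eq_bigr => -[[i j] k] _ /=; rewrite -!exprM -!exprD.
  by congr ('X^_); rewrite /F /=; lia.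
have dec t : decomposes p q r (F t)%:Z t.1.1%:Z t.1.2%:Z t.2%:Z 0.
  case: t => [[i j] k]; rewrite /F /=; split; rewrite ?ltz_nat ?ltn_ord //.
  by lia.
rewrite coef_sum; under eq_bigr => t _ do rewrite coefXn.
case: (pickP (fun t => n == F t)) => [t /eqP nt|none].
  have := dec t; rewrite -nt => dt.
  have [_ _ _ ->] := decomposes_unique pq pr qr (XYZK n%:Z) dt.
  rewrite (bigD1 t) //= nt eqxx big1 ?addr0 // => u ut.
  case: eqP => // Eu; case/eqP: ut.
  have := dec u; rewrite -Eu -nt => du.
  have [Ei Ej Ek _] := decomposes_unique pq pr qr du dt.
  case: u t Ei Ej Ek {du dt Eu nt} => [[i j] k] [[i' j'] k'] /= [Ei] [Ej] [Ek].
  by congr (_, _, _); apply: val_inj.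
rewrite big1 => [|t _]; last by rewrite none.
case: eqP => // K0; have [] := XYZK n%:Z; rewrite K0 => xP yP zP nE.
case: (X _) (Y _) (Z _) xP yP zP nE => x [] y [] z //= xP yP zP nE.
by have := none (Ordinal (xP : (x < p)%N), Ordinal (yP : (y < q)%N),
  Ordinal (zP : (z < r)%N)); rewrite /F /=; lia.
Qed.

Lemma coef_Xn_geom_box (j n : nat) :
  ('X^j * geom_box p q r)`_n = (K (n%:Z - j%:Z) == 0)%:R.
Proof.
rewrite coefXnM; case: ltnP => nj; last first.
  by rewrite coef_geom_box; congr (K _ == 0)%:R; lia.
(* Here [n - j] is negative, while carry 0 would make it a sum of nonnegative terms. *)
case: eqP => // K0; have [] := XYZK (n%:Z - j%:Z); rewrite K0.
by nia.
Qed.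

(** Effect on coefficients of multiplying by [(X^q - 1)(X^r - 1)]. *)
Definition second_diff (f : int -> int) (m : int) : int :=
  f m - f (m - q%:Z) - f (m - r%:Z) + f (m - r%:Z - q%:Z).

Lemma Phi_ternary_coef (n : nat) : prime p -> prime q -> prime r ->
  (n < p * q * r)%N ->
  'Phi_(p * q * r)`_n =
  \sum_(i < p) second_diff (fun m => (K m == 0)%:R) (n%:Z - i%:Z).
Proof.
move=> pp prq prr nN.
have neq a b : prime a -> coprime a b -> a != b.
  by move=> pa; rewrite prime_coprime //; apply: contraNneq => <-.
have := congr1 (fun P : {poly int} => P`_n)
  (Phi_ternary_geom pp prq prr (neq _ _ pp pq) (neq _ _ pp pr)
    (neq _ _ prq qr)).
set N := (p * q * r)%N in nN *.
(* [(X^N - 1)^2] is 1 modulo [X^N], so coefficients below [N] are unaffected. *)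
have -> : 'Phi_N * ('X^N - 1) ^+ 2 = 'X^N * ('Phi_N * ('X^N - 2%:R)) + 'Phi_N
  :> {poly int} by ring.
rewrite coefD coefXnM nN add0r => ->.
rewrite -!mulrA mulr_suml coef_sum; apply: eq_bigr => i _.
have -> : 'X^i * (('X^q - 1) * (('X^r - 1) * geom_box p q r)) =
  'X^i * geom_box p q r - 'X^(i + q) * geom_box p q r
  - 'X^(i + r) * geom_box p q r + 'X^(i + r + q) * geom_box p q r.
  by rewrite !exprD; ring.
rewrite !(coefD, coefN) !coef_Xn_geom_box /second_diff.
by rewrite !PoszD !opprD !addrA.
Qed.

End CoefficientFormula.

(** * Digits and carries over [p] consecutive integers *)

Section Window.
Local Open Scope ring_scope.

Lemma sum_interval_le (p : nat) (a b : int) : a <= b ->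
  \sum_(j < p) (a <= j%:Z < b)%R%:R <= b - a :> int.
Proof.
move=> ab; suff : \sum_(j < p) (a <= j%:Z < b)%R%:R <=
    Num.max 0 (Num.min p%:Z b - a) :> int by lia.
elim: p => [|p IH]; first by rewrite big_ord0; lia.
rewrite big_ord_recr /=; move: IH; set S := \sum_(i < p) _; clearbody S.
by case: (boolP (a <= p%:Z < b)); lia.
Qed.

Context (p q r : nat) (X Y Z K : int -> int).
Hypothesis XYZK : forall m, decomposes p q r m (X m) (Y m) (Z m) (K m).

Lemma sum_window (F : int -> int) (n : int) :
  \sum_(i < p) F (X (n - i%:Z)) = \sum_(j < p) F j%:Z.
Proof.
have Xlt m : (`|X m| < p)%N by have [xP _ _ _] := XYZK m; lia.
pose h (i : 'I_p) := Ordinal (Xlt (n - i%:Z)).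
have hinj : injective h.
  move=> i j [] E; apply/val_inj => /=.
  have [xi _ _ ei] := XYZK (n - i%:Z); have [xj _ _ ej] := XYZK (n - j%:Z).
  have {}E : X (n - i%:Z) = X (n - j%:Z) by lia.
  rewrite E in ei.
  suff : i%:Z = j%:Z by case.
  apply: (@residue_unique p 1); rewrite ?ltz_nat ?ltn_ord //.
    exact: coprimen1.
  rewrite mulr1; apply/dvdzP.
  exists ((Y (n - j%:Z) - Y (n - i%:Z)) * r%:Z +
    (Z (n - j%:Z) - Z (n - i%:Z)) * q%:Z -
    (K (n - j%:Z) - K (n - i%:Z)) * q%:Z * r%:Z).
  by lia.
rewrite [RHS](reindex_inj hinj) /=; apply: eq_bigr => i _.
by congr (F _); have [xP _ _ _] := XYZK (n - i%:Z); lia.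
Qed.

Lemma sum_window_le (f : int -> int) (n a b a' b' : int) :
  a <= b -> a' <= b' ->
  (forall m, n - p%:Z < m <= n ->
    f m <= (a <= X m < b)%R%:R + (a' <= X m < b')%R%:R) ->
  \sum_(i < p) f (n - i%:Z) <= (b - a) + (b' - a').
Proof.
move=> ab ab' H.
pose F (x : int) : int := (a <= x < b)%R%:R + (a' <= x < b')%R%:R.
apply: (@le_trans _ _ (\sum_(i < p) F (X (n - i%:Z)))).
  by apply: ler_sum => i _; apply: H; have := ltn_ord i; lia.
rewrite sum_window big_split /=.
by apply: lerD; apply: sum_interval_le.
Qed.

Lemma carry_range (m : int) : (1 < p)%N -> (1 < q)%N -> (1 < r)%N ->
  - (p + q + r)%N%:Z < m < (p * q * r)%N%:Z -> 0 <= K m <= 2.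
Proof.
move=> p1 q1 r1 mP; have [xP yP zP E] := XYZK m.
have [H1 H2 H3] : [/\ X m * q%:Z * r%:Z <= (p%:Z - 1) * q%:Z * r%:Z,
  Y m * p%:Z * r%:Z <= (q%:Z - 1) * p%:Z * r%:Z &
  Z m * p%:Z * q%:Z <= (r%:Z - 1) * p%:Z * q%:Z].
  by split; do 2 (apply: ler_wpM2r => //); lia.
have [G1 G2 G3] : [/\ 0 <= X m * q%:Z * r%:Z, 0 <= Y m * p%:Z * r%:Z &
  0 <= Z m * p%:Z * q%:Z].
  by split; do 2 (apply: mulr_ge0 => //); lia.
have N0 : 0 < p%:Z * q%:Z * r%:Z by rewrite !mulr_gt0 //; lia.
have S : (p + q + r <= q * r + p * r + p * q)%N by nia.
have E' : K m * (p%:Z * q%:Z * r%:Z) =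
  X m * q%:Z * r%:Z + Y m * p%:Z * r%:Z + Z m * p%:Z * q%:Z - m by lia.
have U : K m * (p%:Z * q%:Z * r%:Z) < 3 * (p%:Z * q%:Z * r%:Z) by lia.
have L : -1 * (p%:Z * q%:Z * r%:Z) < K m * (p%:Z * q%:Z * r%:Z) by lia.
by rewrite ltr_pM2r // in U; rewrite ltr_pM2r // in L; lia.
Qed.

Lemma digit_le (n : nat) (m : int) : (0 < q)%N -> (0 < r)%N ->
  m <= n%:Z -> K m = 0 -> X m <= (n %/ (q * r))%N%:Z.
Proof.
move=> q0 r0 mn K0; have [xP yP zP] := XYZK m; rewrite K0 => E.
have [G2 G3] : 0 <= Y m * p%:Z * r%:Z /\ 0 <= Z m * p%:Z * q%:Z.
  by split; do 2 (apply: mulr_ge0 => //); lia.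
suff : (`|X m| <= n %/ (q * r))%N by lia.
rewrite leq_divRL ?muln_gt0 ?q0 //.
have -> : (`|X m| * (q * r) <= n)%N = (X m * q%:Z * r%:Z <= n%:Z).
  by case: (X m) xP => // x _; rewrite -mulrA -!PoszM.
by lia.
Qed.

Lemma digit_gt (n : nat) (m : int) : (1 < p)%N -> (1 < q)%N -> (1 < r)%N ->
  n%:Z - (p + q + r)%N%:Z < m -> K m = 2 -> (n %/ (q * r))%N%:Z < X m.
Proof.
move=> p1 q1 r1 mn K2; have [xP yP zP] := XYZK m; rewrite K2 => E.
have [H2 H3] : Y m * p%:Z * r%:Z <= (q%:Z - 1) * p%:Z * r%:Z /\
  Z m * p%:Z * q%:Z <= (r%:Z - 1) * p%:Z * q%:Z.
  by split; do 2 (apply: ler_wpM2r => //); lia.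
have S : (p + q + r <= p * r + p * q)%N by nia.
suff : (n %/ (q * r) < `|X m|)%N by lia.
rewrite ltn_divLR; last by rewrite muln_gt0; lia.
have -> : (n < `|X m| * (q * r))%N = (n%:Z < X m * q%:Z * r%:Z).
  by case: (X m) xP => // x _; rewrite -mulrA -!PoszM.
by lia.
Qed.

Hypotheses (pq : coprime p q) (pr : coprime p r) (qr : coprime q r).

Lemma decomposition_sub (s c : nat) (m : int) :
  (0 < s <= p)%N -> (0 < c <= r)%N -> (s * r + c * p = 1 + p * r)%N ->
  [/\ X (m - q%:Z) = X m - s%:Z + (X m < s%:Z)%R%:Z * p%:Z,
      Y (m - q%:Z) = Y m,
      Z (m - q%:Z) = Z m - c%:Z + (Z m < c%:Z)%R%:Z * r%:Z &
      K (m - q%:Z) = K m - 1 + (X m < s%:Z)%R%:Z + (Z m < c%:Z)%R%:Z].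
Proof.
move=> sP cP E; apply: (decomposes_unique pq pr qr (XYZK _)).
exact: decomposes_sub.
Qed.

End Window.

(* [b1], [b2], [b3] record whether [x] wraps around in the steps from [m] to
   [m - q], from [m] to [m - r] and from [m - r] to [m - r - q]. *)
Section CarryPatterns.
Local Open Scope ring_scope.

Context (by_ bz b1 b2 b3 : bool) (k kq kr kqr : int).
Hypotheses (k1 : kq = k - 1 + b1%:Z + bz%:Z) (k2 : kr = k - 1 + b2%:Z + by_%:Z)
  (k3 : kqr = kr - 1 + b3%:Z + bz%:Z).
Hypotheses (kP : 0 <= k <= 2) (kqP : 0 <= kq <= 2) (krP : 0 <= kr <= 2)
  (kqrP : 0 <= kqr <= 2).

Let f : int := (k == 0)%:R - (kq == 0)%:R - (kr == 0)%:R + (kqr == 0)%:R.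

Let carry_cases : k = 0 \/ k = 1 \/ k = 2.
Proof. by lia. Qed.

Lemma carry_wrap_both : (b1, b2, b3) = (true, true, false) -> 0 <= f <= 1.
Proof.
case=> e1 e2 e3; move: kqP krP kqrP; rewrite /f k3 k2 k1 e1 e2 e3.
by case: carry_cases => [->|[->|->]]; case: by_; case: bz.
Qed.

Lemma carry_wrap_second : (b1, b2, b3) = (false, false, true) -> -1 <= f <= 0.
Proof.
case=> e1 e2 e3; move: kqP krP kqrP; rewrite /f k3 k2 k1 e1 e2 e3.
by case: carry_cases => [->|[->|->]]; case: by_; case: bz.
Qed.

Lemma carry_wrap_none : (b1, b2, b3) = (false, false, false) ->
  f = 0 \/ [/\ f = 1, k = 2 & kqr = 0].
Proof.
case=> e1 e2 e3; move: kqP krP kqrP; rewrite /f k3 k2 k1 e1 e2 e3.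
by case: carry_cases => [->|[->|->]]; case: by_; case: bz => //;
  (by left) || (by right).
Qed.

Lemma carry_wrap_all : (b1, b2, b3) = (true, true, true) ->
  f = 0 \/ [/\ f = 1, k = 0 & kqr = 2].
Proof.
case=> e1 e2 e3; move: kqP krP kqrP; rewrite /f k3 k2 k1 e1 e2 e3.
by case: carry_cases => [->|[->|->]]; case: by_; case: bz => //;
  (by left) || (by right).
Qed.

Lemma carry_wrap_r : (b1, b2, b3) = (false, true, false) ->
  f = 0 \/ [/\ f = -1, kq = 0 & kr = 2].
Proof.
case=> e1 e2 e3; move: kqP krP kqrP; rewrite /f k3 k2 k1 e1 e2 e3.
by case: carry_cases => [->|[->|->]]; case: by_; case: bz => //;
  (by left) || (by right).
Qed.

End CarryPatterns.

Section PointwiseBounds.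
Local Open Scope ring_scope.

Context (p q r : nat) (X Y Z K : int -> int).
Hypotheses (pq : coprime p q) (pr : coprime p r) (qr : coprime q r).
Hypothesis XYZK : forall m, decomposes p q r m (X m) (Y m) (Z m) (K m).
Hypotheses (p1 : (1 < p)%N) (q1 : (1 < q)%N) (r1 : (1 < r)%N).
Context (s c t d n : nat).
Hypotheses (sP : (0 < s < p)%N) (cP : (0 < c <= r)%N)
  (sc : (s * r + c * p = 1 + p * r)%N).
Hypotheses (tP : (0 < t < p)%N) (dP : (0 < d <= q)%N)
  (td : (t * q + d * p = 1 + p * q)%N).
Hypothesis nN : (n < p * q * r)%N.

Let X0 : int := (n %/ (q * r))%N%:Z.

Lemma diff_bounds (m : int) : (s <= t)%N -> n%:Z - p%:Z < m <= n%:Z ->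
  let f := second_diff q r (fun m => (K m == 0)%:R) m in let x := X m in
  if (s + t <= p)%N then
    [/\ f <= (0 <= x < s%:Z)%R%:R + (s%:Z + t%:Z <= x < p%:Z)%R%:R,
        f <= (0 <= x < s%:Z)%R%:R + (X0 + 1 <= x < X0 + 1 + s%:Z + t%:Z)%R%:R,
        - f <= (t%:Z <= x < t%:Z + s%:Z)%R%:R + (s%:Z <= x < t%:Z)%R%:R &
        - f <= (t%:Z <= x < t%:Z + s%:Z)%R%:R +
               (X0 + 1 + t%:Z - p%:Z <= x < X0 + 1 + s%:Z)%R%:R]
  else
    [/\ f <= (s%:Z + t%:Z - p%:Z <= x < s%:Z)%R%:R +
             (0 <= x < s%:Z + t%:Z - p%:Z)%R%:R,
        f <= (s%:Z + t%:Z - p%:Z <= x < s%:Z)%R%:R +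
             (X0 + 1 + s%:Z + t%:Z - p%:Z - p%:Z <= x < X0 + 1)%R%:R,
        - f <= (t%:Z <= x < p%:Z)%R%:R + (s%:Z <= x < t%:Z)%R%:R &
        - f <= (t%:Z <= x < p%:Z)%R%:R +
               (X0 + 1 + t%:Z - p%:Z <= x < X0 + 1 + s%:Z)%R%:R].
Proof.
move=> st mP f x; rewrite {}/f {}/x /second_diff.
have sP' : (0 < s <= p)%N by lia.
have tP' : (0 < t <= p)%N by lia.
have mr (m' : int) : n%:Z - (p + q + r)%N%:Z < m' <= n%:Z ->
    [/\ 0 <= K m' <= 2, (K m' = 0 -> X m' <= X0) & (K m' = 2 -> X0 < X m')].
  move=> m'P; split.
  - by apply: (carry_range XYZK) => //; lia.
  - by apply: (digit_le XYZK); lia.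
  - by apply: (digit_gt XYZK) => //; lia.
have [a0 b0 c0] := mr m ltac:(lia).
have [a1 b1 c1] := mr (m - q%:Z) ltac:(lia).
have [a2 b2 c2] := mr (m - r%:Z) ltac:(lia).
have [a3 b3 c3] := mr (m - r%:Z - q%:Z) ltac:(lia).
have sub_r (m' : int) :
    [/\ X (m' - r%:Z) = X m' - t%:Z + (X m' < t%:Z)%R%:Z * p%:Z,
      Z (m' - r%:Z) = Z m' &
      K (m' - r%:Z) = K m' - 1 + (X m' < t%:Z)%R%:Z + (Y m' < d%:Z)%R%:Z].
  have [] := @decomposition_sub p r q X Z Y K _ pr pq _ t d m' tP' dP td.
  - by move=> m''; apply: decomposes_swap.
  - by rewrite coprime_sym.
  by move=> -> -> _ ->.
have [x1 _ _ k1] := decomposition_sub XYZK pq pr qr m sP' cP sc.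
have [x2 z2 k2] := sub_r m.
have [x3 _ _ k3] := decomposition_sub XYZK pq pr qr (m - r%:Z) sP' cP sc.
rewrite {}z2 in k3.
have [xP _ _ _] := XYZK m.
have all := carry_wrap_all k1 k2 k3 a0 a1 a2 a3.
have none := carry_wrap_none k1 k2 k3 a0 a1 a2 a3.
have both := carry_wrap_both k1 k2 k3 a0 a1 a2 a3.
have second := carry_wrap_second k1 k2 k3 a0 a1 a2 a3.
have wrap_r := carry_wrap_r k1 k2 k3 a0 a1 a2 a3.
move: all none both second wrap_r; set f := (K m == 0)%:R - _ - _ + _.
clearbody f; move: x1 x2 x3 xP b0 c0 b1 c1 b2 c2 b3 c3.
move: X0 (X m) (X (m - q%:Z)) (X (m - r%:Z)) (X (m - r%:Z - q%:Z)).
move: (K m) (K (m - q%:Z)) (K (m - r%:Z)) (K (m - r%:Z - q%:Z)) f.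
clear - st sP tP => k kq kr kqr f x0 x xq xr xqr x1 x2 x3 xP.
case: (leqP (s + t) p) => stp.
- have [cA|[cB|[cC|cD]]] : x < s%:Z \/ s%:Z <= x < t%:Z \/
    t%:Z <= x < t%:Z + s%:Z \/ s%:Z + t%:Z <= x by clear - tP st; lia.
  + have E : (x < s%:Z, x < t%:Z, xr < s%:Z) = (true, true, false).
      by clear - sP tP st stp cA xP x2; congr (_, _, _); lia.
    move=> _ _ _ _ _ _ _ _ all none both second wrap_r.
    have {all none both second wrap_r} fP := both E.
    clear - sP tP st stp cA xP fP; split; lia.
  + have E : (x < s%:Z, x < t%:Z, xr < s%:Z) = (false, true, false).
      by clear - sP tP st stp cB xP x2; congr (_, _, _); lia.
    have Eq : xq = x - s%:Z by clear - sP tP st stp cB xP x1; lia.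
    have Er : xr = x - t%:Z + p%:Z by clear - sP tP st stp cB xP x2; lia.
    move=> _ _ b1 _ _ c2 _ _ _ _ _ _ wrap_r.
    have fP : f = 0 \/ [/\ f = -1, xq <= x0 & x0 < xr].
      by case: (wrap_r E) => [f0|[f1 /b1 ? /c2 ?]]; [left|right].
    clear - sP tP st stp cB xP fP Eq Er; case: fP => [|[]]; split; lia.
  + have E : (x < s%:Z, x < t%:Z, xr < s%:Z) = (false, false, true).
      by clear - sP tP st stp cC xP x2; congr (_, _, _); lia.
    move=> _ _ _ _ _ _ _ _ all none both second wrap_r.
    have {all none both second wrap_r} fP := second E.
    clear - sP tP st stp cC xP fP; split; lia.
  + have E : (x < s%:Z, x < t%:Z, xr < s%:Z) = (false, false, false).
      by clear - sP tP st stp cD xP x2; congr (_, _, _); lia.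
    have Eqr : xqr = x - t%:Z - s%:Z by clear - sP tP st stp cD xP x2 x3; lia.
    move=> _ c0 _ _ _ _ b3 _ _ none _ _ _.
    have fP : f = 0 \/ [/\ f = 1, x0 < x & xqr <= x0].
      by case: (none E) => [f0|[f1 /c0 ? /b3 ?]]; [left|right].
    clear - sP tP st stp cD xP fP Eqr; case: fP => [|[]]; split; lia.
- have [cA|[cB|[cC|cD]]] : x < s%:Z + t%:Z - p%:Z \/
    s%:Z + t%:Z - p%:Z <= x < s%:Z \/
    s%:Z <= x < t%:Z \/ t%:Z <= x by clear; lia.
  + have E : (x < s%:Z, x < t%:Z, xr < s%:Z) = (true, true, true).
      by clear - sP tP st stp cA xP x2; congr (_, _, _); lia.
    have Eqr : xqr = x - t%:Z - s%:Z + p%:Z + p%:Z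
      by clear - sP tP st stp cA xP x2 x3; lia.
    move=> b0 _ _ _ _ _ _ c3 all _ _ _ _.
    have fP : f = 0 \/ [/\ f = 1, x <= x0 & x0 < xqr].
      by case: (all E) => [f0|[f1 /b0 ? /c3 ?]]; [left|right].
    clear - sP tP st stp cA xP fP Eqr; case: fP => [|[]]; split; lia.
  + have E : (x < s%:Z, x < t%:Z, xr < s%:Z) = (true, true, false).
      by clear - sP tP st stp cB xP x2; congr (_, _, _); lia.
    move=> _ _ _ _ _ _ _ _ all none both second wrap_r.
    have {all none both second wrap_r} fP := both E.
    clear - sP tP st stp cB xP fP; split; lia.
  + have E : (x < s%:Z, x < t%:Z, xr < s%:Z) = (false, true, false).
      by clear - sP tP st stp cC xP x2; congr (_, _, _); lia.
    have Eq : xq = x - s%:Z by clear - sP tP st stp cC xP x1; lia.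
    have Er : xr = x - t%:Z + p%:Z by clear - sP tP st stp cC xP x2; lia.
    move=> _ _ b1 _ _ c2 _ _ _ _ _ _ wrap_r.
    have fP : f = 0 \/ [/\ f = -1, xq <= x0 & x0 < xr].
      by case: (wrap_r E) => [f0|[f1 /b1 ? /c2 ?]]; [left|right].
    clear - sP tP st stp cC xP fP Eq Er; case: fP => [|[]]; split; lia.
  + have E : (x < s%:Z, x < t%:Z, xr < s%:Z) = (false, false, true).
      by clear - sP tP st stp cD xP x2; congr (_, _, _); lia.
    move=> _ _ _ _ _ _ _ _ all none both second wrap_r.
    have {all none both second wrap_r} fP := second E.
    clear - sP tP st stp cD xP fP; split; lia.
Qed.

End PointwiseBounds.

Lemma modn_eq1 (p a : nat) : 1 < p -> a = 1 %[mod p] ->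
  exists j, a = 1 + j * p.
Proof.
move=> p1 H; exists (a %/ p).
by rewrite {1}(divn_eq a p) H modn_small // addnC.
Qed.

Lemma cross_inverse (p r s : nat) : 1 < p -> 0 < r -> s < p ->
  r * s = 1 %[mod p] ->
  exists2 c, 0 < c <= r & s * r + c * p = 1 + p * r.
Proof.
move=> p1 r0 sp /(modn_eq1 p1) [j E].
have jr : j < r by rewrite -(@ltn_pmul2r p); nia.
have jp : j * p <= r * p by rewrite leq_mul2r ltnW ?orbT.
by exists (r - j); [lia | rewrite mulnBl; lia].
Qed.

Section HeightBound.
Local Open Scope ring_scope.

Lemma Phi_ternary_coef_bounds (p q r s t n : nat) :
  prime p -> prime q -> prime r -> q != r -> (p < q)%N -> (p < r)%N ->
  (0 < s < p)%N -> (r * s = 1 %[mod p])%N ->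
  (0 < t < p)%N -> (q * t = 1 %[mod p])%N ->
  (s <= t)%N -> (n < p * q * r)%N ->
  let a : int := 'Phi_(p * q * r)`_n in
  if (s + t <= p)%N then
    [/\ a <= p%:Z - t%:Z, a <= 2 * s%:Z + t%:Z, - a <= t%:Z &
        - a <= 2 * s%:Z + (p%:Z - t%:Z)]
  else
    [/\ a <= s%:Z, a <= 2 * (p%:Z - t%:Z) + (p%:Z - s%:Z), - a <= p%:Z - s%:Z &
        - a <= 2 * (p%:Z - t%:Z) + s%:Z].
Proof.
move=> pp prq prr qr pq pr sP rs tP qt st nN a; rewrite {}/a.
have [p1 q1 r1] : [/\ (1 < p)%N, (1 < q)%N & (1 < r)%N] by rewrite !prime_gt1.
have cop a b : prime a -> prime b -> a != b -> coprime a b.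
  by move=> pa pb ab; rewrite prime_coprime // dvdn_prime2.
have {}pq : coprime p q by apply: cop => //; rewrite neq_ltn pq.
have {}pr : coprime p r by apply: cop => //; rewrite neq_ltn pr.
have {}qr : coprime q r by exact: cop.
have [X [Y [Z [K D]]]] :=
  decomposition_exists (ltnW p1) (ltnW q1) (ltnW r1) pq pr qr.
have [|c cP sc] := cross_inverse p1 (ltnW r1) _ rs; first by lia.
have [|d dP td] := cross_inverse p1 (ltnW q1) _ qt; first by lia.
have B m := diff_bounds pq pr qr D p1 q1 r1 sP cP sc tP dP td nN st (m := m).
rewrite (Phi_ternary_coef pq pr qr D pp prq prr nN) -sumrN.
set f := second_diff q r _ in B *.
have up := @sum_window_le p q r X Y Z K D f n%:Z.
have down := @sum_window_le p q r X Y Z K D (fun m => - f m) n%:Z.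
move: B; case: ifP => stp B; split.
- by apply: le_trans (up _ _ _ _ _ _ (fun m mP =>
    let: And4 H _ _ _ := B m mP in H)) _; lia.
- by apply: le_trans (up _ _ _ _ _ _ (fun m mP =>
    let: And4 _ H _ _ := B m mP in H)) _; lia.
- by apply: le_trans (down _ _ _ _ _ _ (fun m mP =>
    let: And4 _ _ H _ := B m mP in H)) _; lia.
- by apply: le_trans (down _ _ _ _ _ _ (fun m mP =>
    let: And4 _ _ _ H := B m mP in H)) _; lia.
- by apply: le_trans (up _ _ _ _ _ _ (fun m mP =>
    let: And4 H _ _ _ := B m mP in H)) _; lia.
- by apply: le_trans (up _ _ _ _ _ _ (fun m mP =>
    let: And4 _ H _ _ := B m mP in H)) _; lia.
- by apply: le_trans (down _ _ _ _ _ _ (fun m mP =>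
    let: And4 _ _ H _ := B m mP in H)) _; lia.
- by apply: le_trans (down _ _ _ _ _ _ (fun m mP =>
    let: And4 _ _ _ H := B m mP in H)) _; lia.
Qed.

Lemma beta_eq (p q r s t beta : nat) : (1 < p)%N ->
  (r * s = 1 %[mod p])%N -> (q * t = 1 %[mod p])%N ->
  (0 < t < p)%N -> (0 < beta < p)%N ->
  (s * beta * q * r = 1 %[mod p])%N -> beta = t.
Proof.
move=> p1 /(modn_eq1 p1) [b rs] /(modn_eq1 p1) [a qt] tP bP.
move=> /(modn_eq1 p1) [k e].
have rsZ : r%:Z * s%:Z = 1 + b%:Z * p%:Z by lia.
have qtZ : q%:Z * t%:Z = 1 + a%:Z * p%:Z by lia.
have eZ : s%:Z * beta%:Z * q%:Z * r%:Z = 1 + k%:Z * p%:Z by lia.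
suff : beta%:Z = t%:Z by case.
apply: (@residue_unique p 1); [exact: coprimen1 | by lia | by lia |].
rewrite mulr1; apply/dvdzP.
exists (t%:Z * k%:Z - beta%:Z * (a%:Z + b%:Z + a%:Z * b%:Z * p%:Z)).
have : beta%:Z * (q%:Z * t%:Z) * (r%:Z * s%:Z) =
  t%:Z * (s%:Z * beta%:Z * q%:Z * r%:Z) by ring.
by rewrite rsZ qtZ eZ; lia.
Qed.

Lemma beta_eq_opp (p q r s t beta : nat) : (1 < p)%N ->
  (r * s = 1 %[mod p])%N -> (q * t = 1 %[mod p])%N ->
  (0 < s < p)%N -> (t < p)%N -> (0 < beta < p)%N ->
  ((p - t) * beta * q * r = 1 %[mod p])%N -> beta = (p - s)%N.
Proof.
move=> p1 /(modn_eq1 p1) [b rs] /(modn_eq1 p1) [a qt] sP tP bP.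
move=> /(modn_eq1 p1) [k e].
have rsZ : r%:Z * s%:Z = 1 + b%:Z * p%:Z by lia.
have qtZ : q%:Z * t%:Z = 1 + a%:Z * p%:Z by lia.
have eZ : (p%:Z - t%:Z) * beta%:Z * q%:Z * r%:Z = 1 + k%:Z * p%:Z.
  by rewrite (subzn (ltnW tP)); lia.
suff : beta%:Z = p%:Z - s%:Z by lia.
apply: (@residue_unique p 1); [exact: coprimen1 | by lia | by lia |].
rewrite mulr1; apply/dvdzP.
exists (s%:Z * k%:Z * -1 + beta%:Z * q%:Z * (1 + b%:Z * p%:Z)
        - beta%:Z * (a%:Z + b%:Z + a%:Z * b%:Z * p%:Z) - 1).
have : s%:Z * ((p%:Z - t%:Z) * beta%:Z * q%:Z * r%:Z) =
  p%:Z * beta%:Z * q%:Z * (r%:Z * s%:Z)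
  - beta%:Z * (q%:Z * t%:Z) * (r%:Z * s%:Z) by ring.
by rewrite rsZ qtZ eZ; lia.
Qed.

End HeightBound.

Lemma size_Phi_ternary (p q r : nat) : prime p -> prime q -> prime r ->
  coprime p q -> coprime (p * q) r ->
  size ('Phi_(p * q * r)) <= p * q * r.
Proof.
move=> pp pq pr cpq cpqr; rewrite size_Cyclotomic !totient_coprime //.
rewrite !totient_prime //.
have [p1 q1 r1] : [/\ 1 < p, 1 < q & 1 < r] by rewrite !prime_gt1.
have H1 : p.-1 * q.-1 <= p * q by apply: leq_mul; apply: leq_pred.
have H2 : 0 < p * q by rewrite muln_gt0; lia.
have H3 : p.-1 * q.-1 * r.-1 <= p * q * r.-1 by rewrite leq_mul2r H1 orbT.
by apply: (leq_ltn_trans H3); rewrite ltn_pmul2l //; lia.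
Qed.

Lemma cyc_height_ternary_le (p q r s t beta : nat) :
  prime p -> prime q -> prime r -> q != r -> p < q -> p < r ->
  0 < s < p -> r * s = 1 %[mod p] -> 0 < t < p -> q * t = 1 %[mod p] ->
  s <= t ->
  let alpha := minn s (p - t) in
  0 < beta < p -> alpha * beta * q * r = 1 %[mod p] ->
  cyc_height (p * q * r) <=
    minn (2 * alpha + minn beta (p - beta)) (p - minn beta (p - beta)).
Proof.
move=> pp prq prr qr pq pr sP rs tP qt st alpha bP E.
have p1 := prime_gt1 pp.
have cop a b : prime a -> prime b -> a != b -> coprime a b.
  by move=> pa pb ab; rewrite prime_coprime // dvdn_prime2.
apply/bigmax_leqP => -[n /= ns] _.
have nN : n < p * q * r.
  apply: leq_trans ns (size_Phi_ternary _ _ _ _ _) => //.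
    by apply: cop => //; rewrite neq_ltn pq.
  by rewrite coprimeMl !cop // neq_ltn pr.
have := Phi_ternary_coef_bounds pp prq prr qr pq pr sP rs tP qt st nN.
rewrite /cyc_coef /=; move: (('Phi_ _)`_n)%R => a.
case: (leqP (s + t) p) => stp [].
- have Ea : alpha = s by rewrite /alpha; clear - sP st stp; lia.
  rewrite Ea in E *; have -> := beta_eq p1 rs qt tP bP E.
  by clear - sP tP; lia.
- have Ea : alpha = p - t by rewrite /alpha; clear - tP st stp; lia.
  have tp : t < p by case/andP: tP.
  rewrite Ea in E *; have -> := beta_eq_opp p1 rs qt sP tp bP E.
  by clear - sP tP; lia.
Qed.

Theorem theorem2 (p q r q' r' beta : nat) :
  prime p -> prime q -> prime r ->
  q != r -> p < q -> p < r ->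
  0 < q' < p -> q * q' = 1 %[mod p] ->
  0 < r' < p -> r * r' = 1 %[mod p] ->
  let alpha := minn (minn q' r') (minn (p - q') (p - r')) in
  0 < beta < p -> alpha * beta * q * r = 1 %[mod p] ->
  let betastar := minn beta (p - beta) in
  cyc_height (p * q * r) <= minn (2 * alpha + betastar) (p - betastar).
Proof.
move=> pp prq prr qr pq pr q'P qq' r'P rr' alpha bP E; cbv zeta.
case: (leqP r' q') => [le|/ltnW le].
- have Ea : alpha = minn r' (p - q') by rewrite /alpha; clear - le; lia.
  by rewrite Ea in E *; apply: cyc_height_ternary_le le bP E.
- have Ea : alpha = minn q' (p - r') by rewrite /alpha; clear - le; lia.
  rewrite Ea mulnAC in E *; rewrite mulnAC.
  by apply: cyc_height_ternary_le le bP E => //; rewrite eq_sym.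
Qed.
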